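(* Suppose that $E(Y^2)<\infty$, $E(\|X\|^2)<\infty$, $V(Y)>0$, $V(X)$ is non-singular, and $E(Y|X)=\alpha_0+X'\beta_0$ for some $(\alpha_0,\beta_0)\in\mathbb{R}\times\mathbb{R}^p$. Let $U:=Y_0-X_0'\beta_0$. Then: 1. If there exists a convex function $\phi:\mathbb{R}\to\mathbb{R}$ such that $E[\phi(U\lambda)]<E[\phi(X_0'\beta_0\lambda)]=\infty$ for all $\lambda>1$, the identified set of $\beta_0$ (under this additional restriction) is included in the boundary $\partial\mathcal{B}$ of $\mathcal{B}$. 2. If $p=1$ (that is, $X\in\mathbb{R}$), there exists a convex function $\phi:\mathbb{R}\to\mathbb{R}$ such that $E[\phi(U\lambda)]<E[\phi(X\lambda)]=\infty$ for all $\lambda>0$, and it is known that $\beta_0>0$, then $\beta_0$ is point identified (that is, under these additional restrictions the identified set of $\beta_0$ is $\{\beta_0\}$).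
   Context: $Y$ is a real random variable and $X$ a random vector in $\mathbb{R}^p$; only the marginal distributions of $Y$ and $X$ are known. $V(\cdot)$ is the variance (matrix), $\overset{d}{=}$ equality in distribution, and $A_0:=A-E(A)$ for integrable $A$. For convex $\phi$ and integrable $A$, $E[\phi(A)]\in(-\infty,\infty]$ is always well-defined. Without additional restrictions, the identified set of $\beta_0$ is $$\mathcal{B}=\left\{\beta\in\mathbb{R}^p:\ \exists\text{ random variables }(\widetilde X,\widetilde Y):\ E(\widetilde Y_0|\widetilde X_0)=\widetilde X_0'\beta,\ \widetilde X\overset{d}{=}X,\ \widetilde Y\overset{d}{=}Y\right\}.$$ The identified set under additional restrictions is the set of $\beta\in\mathbb{R}^p$ for which there exists such a pair $(\widetilde X,\widetilde Y)$ that, in addition, satisfies the stated restrictions with $(X,Y,\beta_0,U)$ replaced by $(\widetilde X,\widetilde Y,\beta,\widetilde Y_0-\widetilde X_0'\beta)$. *)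

(* Defs.v *)
From HB Require Import structures.
From mathcomp Require Import all_boot all_order all_algebra.
From mathcomp Require Import all_classical all_reals all_analysis.

Set Implicit Arguments.
Unset Strict Implicit.
Unset Printing Implicit Defensive.

Import Order.TTheory GRing.Theory Num.Theory.
Import numFieldTopology.Exports numFieldNormedType.Exports.

Local Open Scope classical_set_scope.
Local Open Scope ring_scope.

Definition borelV (R : realType) (p : nat) :=
  g_sigma_algebraType (@open 'rV[R]_p).

Definition dotp (R : realType) (p : nat) (u v : 'rV[R]_p) : R :=
  \sum_(i < p) u 0 i * v 0 i.

Definition coord_of (R : realType) (p : nat) (T : Type) (X : T -> 'rV[R]_p)
  (i : 'I_p) : T -> R := fun w => X w 0 i.

Definition centered d (T : measurableType d) (R : realType)
    (P : probability T R) (A : T -> R) : T -> R :=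
  fun w => A w - fine 'E_P[A]%E.

Definition centeredV d (T : measurableType d) (R : realType)
    (P : probability T R) (p : nat) (X : T -> 'rV[R]_p) : T -> 'rV[R]_p :=
  fun w => X w - \row_i fine 'E_P[coord_of X i]%E.

Definition covmx d (T : measurableType d) (R : realType)
    (P : probability T R) (p : nat) (X : T -> 'rV[R]_p) : 'M[R]_p :=
  \matrix_(i, j) fine (covariance P (coord_of X i) (coord_of X j)).

(* E(Y | V) = Z: the function Z is a version of the conditional expectation of
   Y given the sigma-algebra generated by V. *)
Definition is_cond_expectation d (T : measurableType d) (R : realType)
    (P : probability T R) d' (T' : measurableType d') (V : T -> T')
    (Y Z : T -> R) : Prop :=
  [/\ P.-integrable [set: T] (EFin \o Y),
      P.-integrable [set: T] (EFin \o Z),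
      measurable_fun [set: g_sigma_algebra_preimageType V]
        (Z : g_sigma_algebra_preimageType V -> R)
    & forall A : set T, g_sigma_algebra_preimage V A ->
        (\int[P]_(w in A) (Z w)%:E = \int[P]_(w in A) (Y w)%:E)%E].

Definition eq_in_dist (R : realType) d1 (T1 : measurableType d1)
    (P1 : probability T1 R) d2 (T2 : measurableType d2)
    (P2 : probability T2 R) d' (T' : measurableType d')
    (A1 : {RV P1 >-> T'}) (A2 : {RV P2 >-> T'}) : Prop :=
  forall B : set T', measurable B -> distribution P1 A1 B = distribution P2 A2 B.

Definition residual d (T : measurableType d) (R : realType)
    (P : probability T R) (p : nat) (X : T -> 'rV[R]_p) (Y : T -> R)
    (beta : 'rV[R]_p) : T -> R :=
  fun w => centered P Y w - dotp (centeredV P X w) beta.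

(* A restriction on (X, Y, beta, U), where the probability space carrying the
   random variables is itself an argument. *)
Definition restriction (R : realType) (p : nat) :=
  forall d (T : measurableType d) (P : probability T R),
    (T -> 'rV[R]_p) -> (T -> R) -> 'rV[R]_p -> (T -> R) -> Prop.

Definition no_restriction (R : realType) (p : nat) : restriction R p :=
  fun d T P X Y beta U => True.

Definition identified_set (R : realType) (p : nat) d (T : measurableType d)
    (P : probability T R) (X : {RV P >-> borelV R p}) (Y : {RV P >-> R})
    (r : restriction R p) : set 'rV[R]_p :=
  [set beta | exists d' (T' : measurableType d') (P' : probability T' R)
      (X' : {RV P' >-> borelV R p}) (Y' : {RV P' >-> R}),
      [/\ is_cond_expectation P' (centeredV P' X' : T' -> borelV R p)
            (centered P' Y') (fun w => dotp (centeredV P' X' w) beta),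
          eq_in_dist X' X,
          eq_in_dist Y' Y
        & r d' T' P' X' Y' beta (residual P' X' Y' beta)]].

(* E[phi(U l)] < E[phi(S l)] = +oo for some convex phi and all l > l0.  The
   function phi is part of the restriction: it may depend on the candidate
   distribution. *)
Definition tail_dominated d (T : measurableType d) (R : realType)
    (P : probability T R) (U S : T -> R) (l0 : R) : Prop :=
  exists phi : R -> R, convex_function [set: R] phi /\
    forall l : R, l0 < l ->
      ('E_P[fun w => phi (U w * l)%R] < 'E_P[fun w => phi (S w * l)%R])%E /\
      ('E_P[fun w => phi (S w * l)%R] = +oo)%E.

Definition index_tail (R : realType) (p : nat) : restriction R p :=
  fun d T P X Y beta U =>
    tail_dominated P U (fun w => dotp (centeredV P X w) beta) 1.

(* The regressor X j enters uncentered. *)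
Definition positive_regressor_tail (R : realType) (p : nat) (j : 'I_p) :
    restriction R p :=
  fun d T P X Y beta U => tail_dominated P U (coord_of X j) 0 /\ 0 < beta 0 j.

Definition boundary (T : topologicalType) (A : set T) : set T :=
  closure A `\` interior A.

(* Main.v *)
Require Import Defs.
From HB Require Import structures.
From mathcomp Require Import all_boot all_order all_algebra.
From mathcomp Require Import all_classical all_reals all_analysis measurable_realfun ring lra.
Set Implicit Arguments.
Unset Strict Implicit.
Unset Printing Implicit Defensive.
Import Order.TTheory GRing.Theory Num.Theory.
Import numFieldTopology.Exports numFieldNormedType.Exports.
Local Open Scope classical_set_scope.
Local Open Scope ring_scope.

(* Couplings of the marginals enter only through Jensen's inequality: if l b
   belongs to the unrestricted set, then E f(l X0'b) <= E f(Y0) for every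
   convex f of linear growth, an inequality between marginal expectations, so
   it also constrains any other coupling.  In a coupling realizing b, with
   residual U, Y0 = l^-1 (l X0'b) + (1 - l^-1) (k U) with k = l / (l - 1), and
   for l > 1 convexity gives E f(l X0'b) <= E f(k U); monotone convergence
   extends this to every convex f.  When E phi(k U) is finite and
   E phi(l X0'b) is not, l b is therefore outside the set for every l > 1.  So
   b is not an interior point, and for p = 1 two positive candidates, being
   multiples of each other, coincide. *)

(** * Support lines of a convex function of one real variable *)

Section convex_real.
Variables (R : realType) (phi : R -> R).
Hypothesis phi_convex : convex_function [set: R] phi.

Lemma convex_function_le (t x y : R) : 0 <= t -> t <= 1 ->
  phi (t * x + (1 - t) * y) <= t * phi x + (1 - t) * phi y.
Proof.
move=> t0 t1.
have h : Itv.spec (@Itv.num_sem R) (Itv.Real `[0%Z, 1%Z]) t.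
  by rewrite /= /Itv.num_sem /= ?num_real /= in_itv /= t0 t1.
have := phi_convex (Itv.mk h) (x := x) (y := y).
by rewrite !inE => /(_ Logic.I Logic.I).
Qed.

(** The point [q] is the convex combination of [y] and [z] with weight [(z - q) / (z - y)] on [y];
    convexity there rearranges into the comparison of slopes. *)
Lemma convex_slope_le (y q z : R) : y < q -> q < z ->
  (phi q - phi y) / (q - y) <= (phi z - phi q) / (z - q).
Proof.
move=> yq qz; have yz := lt_trans yq qz.
have zy0 : z - y != 0 by rewrite subr_eq0 gt_eqF.
have t0 : 0 <= (z - q) / (z - y) by rewrite divr_ge0// subr_ge0 ltW.
have t1 : (z - q) / (z - y) <= 1.
  by rewrite ler_pdivrMr ?subr_gt0// mul1r lerD2l lerN2 ltW.
have := convex_function_le y z t0 t1.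
have -> : (z - q) / (z - y) * y + (1 - (z - q) / (z - y)) * z = q by field.
have -> : (z - q) / (z - y) * phi y + (1 - (z - q) / (z - y)) * phi z =
    ((z - q) * phi y + (q - y) * phi z) / (z - y) by field.
rewrite ler_pdivlMr ?subr_gt0// => h.
rewrite ler_pdivrMr ?subr_gt0// mulrAC ler_pdivlMr ?subr_gt0//.
nra.
Qed.

(** The slope is the left derivative at [q], taken as the supremum of the left difference quotients;
    by [convex_slope_le] every right quotient bounds them. *)
Lemma convex_support_line (q : R) :
  exists s, forall x, phi q + s * (x - q) <= phi x.
Proof.
pose S := [set (phi q - phi y) / (q - y) | y in [set y | y < q]].
have S0 : S !=set0.
  exists ((phi q - phi (q - 1)) / (q - (q - 1))), (q - 1) => //=.
  by rewrite ltrBlDr ltrDl.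
have Sub z : q < z -> ubound S ((phi z - phi q) / (z - q)).
  by move=> qz _ [y yq <-]; exact: convex_slope_le.
exists (sup S) => x; rewrite -lerBrDl; case: (ltgtP x q) => [xq|qx|->].
- rewrite -ler_ndivrMr ?subr_lt0//.
  have -> : (phi x - phi q) / (x - q) = (phi q - phi x) / (q - x).
    by rewrite -[x - q]opprB -[phi x - phi q]opprB invrN mulrNN.
  apply: ub_le_sup; last by exists x.
  by exists ((phi (q + 1) - phi q) / (q + 1 - q)); apply: Sub; rewrite ltrDl.
- by rewrite -ler_pdivlMr ?subr_gt0//; apply: ge_sup => //; exact: Sub.
- by rewrite !subrr mulr0.
Qed.

(** Adding the support inequalities at [x] and at [y] gives [(s y - s x) * (y - x) >= 0]. *)
Lemma support_slope_le (s : R -> R) :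
  (forall q x, phi q + s q * (x - q) <= phi x) -> {homo s : x y / x <= y}.
Proof.
move=> hs x y; rewrite le_eqVlt => /predU1P[->//|xy].
have := hs x y; have := hs y x; nra.
Qed.

End convex_real.

(** * Finite maxima of affine functions, and convex functions as their limits *)

Fixpoint max_affine (R : realType) (a b : nat -> R) (n : nat) (x : R) : R :=
  if n is m.+1 then Num.max (max_affine a b m x) (a n + b n * x)
  else a 0 + b 0 * x.

Section max_affine_theory.
Variables (R : realType) (a b : nat -> R).
Local Notation ma := (max_affine a b).

Lemma max_affine_ge n k x : (k <= n)%N -> a k + b k * x <= ma n x.
Proof.
elim: n => [|n IHn] /=; first by rewrite leqn0 => /eqP->.
rewrite leq_eqVlt ltnS => /predU1P[->|/IHn h]; first by rewrite le_max lexx orbT.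
by rewrite le_max h.
Qed.

Lemma max_affine_le n x c : (forall k, a k + b k * x <= c) -> ma n x <= c.
Proof. by move=> h; elim: n => [|n IHn] //=; rewrite ge_max IHn h. Qed.

Lemma max_affine_nd x : {homo (fun n => ma n x) : m n / (m <= n)%N >-> m <= n}.
Proof.
by apply: homo_leq => //; [exact: le_trans | move=> n; rewrite /= le_max lexx].
Qed.

Lemma max_affine_convex n (t x y : R) : 0 <= t -> t <= 1 ->
  ma n (t * x + (1 - t) * y) <= t * ma n x + (1 - t) * ma n y.
Proof.
move=> t0 t1; elim: n => [|n IHn]; first by rewrite /=; nra.
have hx : ma n x <= ma n.+1 x by exact: max_affine_nd.
have hy : ma n y <= ma n.+1 y by exact: max_affine_nd.
have hx' := @max_affine_ge n.+1 n.+1 x (leqnn _).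
have hy' := @max_affine_ge n.+1 n.+1 y (leqnn _).
rewrite {1}/ma -/ma ge_max; apply/andP; split; nra.
Qed.

Lemma measurable_max_affine n : measurable_fun [set: R] (ma n).
Proof.
elim: n => [|n IHn]; last apply: measurable_maxr => //;
  by apply: measurable_funD => //; exact: measurable_funM.
Qed.

Lemma integrable_affine d (T : measurableType d) (P : probability T R)
    (f : T -> R) (A : set T) (u v : R) : measurable A ->
  P.-integrable A (EFin \o f) -> P.-integrable A (EFin \o (fun w => u + v * f w)).
Proof.
move=> mA fi.
have ci := finite_measure_integrable_cst P u mA.
have vi := integrableZl mA v fi.
exact: (integrableD mA ci vi).
Qed.

Lemma integrable_max d (T : measurableType d) (P : probability T R)
    (f g : T -> R) (A : set T) : measurable A ->
  P.-integrable A (EFin \o f) -> P.-integrable A (EFin \o g) ->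
  P.-integrable A (EFin \o (fun w => Num.max (f w) (g w))).
Proof.
move=> mA fi gi.
have afi := integrable_abse fi; have agi := integrable_abse gi.
apply: (le_integrable mA _ _ (integrableD mA afi agi)).
  apply/measurable_EFinP; apply: measurable_maxr; apply/measurable_EFinP.
    by case/integrableP: fi.
  by case/integrableP: gi.
move=> w _ /=; rewrite lee_fin [leRHS]ger0_norm ?addr_ge0//.
case: (leP (f w) (g w)) => _; [by rewrite lerDr|by rewrite lerDl].
Qed.

(** Linear growth is the point of these test functions: along an integrable variable their integrals
    are finite and can be subtracted. *)
Lemma integrable_max_affine d (T : measurableType d) (P : probability T R)
    (f : T -> R) (A : set T) n : measurable A ->
  P.-integrable A (EFin \o f) -> P.-integrable A (EFin \o (fun w => ma n (f w))).
Proof.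
move=> mA fi; elim: n => [|n IHn] /=; first exact: integrable_affine.
by apply: integrable_max => //; exact: integrable_affine.
Qed.

End max_affine_theory.

(** The lines are support lines at all rational points. Slopes are monotone, hence bounded near [x],
    so the line at a rational slightly to the left of [x] is almost exact at [x]. *)
Lemma convex_max_affine (R : realType) (phi : R -> R) :
  convex_function [set: R] phi ->
  exists a b : nat -> R, (forall k x, a k + b k * x <= phi x) /\
    (forall x, max_affine a b n x @[n --> \oo] --> phi x).
Proof.
move=> /convex_support_line/choice[s hs].
(* An enumeration of the rationals; a code that decodes to nothing only repeats the support line at
   0. *)
pose q k : R := ratr (odflt 0 (unpickle k : option rat)).
pose b k := s (q k); pose a k := phi (q k) - b k * q k.
have abE k x : a k + b k * x = phi (q k) + s (q k) * (x - q k).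
  by rewrite /a /b; ring.
exists a, b; split=> [k x|x]; first by rewrite abE.
have le_phi n : max_affine a b n x <= phi x.
  by apply: max_affine_le => k; rewrite abE.
have hm := support_slope_le hs.
apply/cvgrPdist_le => e e0.
(* [M] bounds [s x - s r] for [r] in [[x - 1, x]], and the line at [r] misses [phi x] by at most
   [(s x - s r) * (x - r)]. Dividing by [M + 1] covers the case [M = 0]. *)
pose M := s x - s (x - 1).
have M0 : 0 <= M by rewrite subr_ge0 hm// gerBl.
pose dl := Num.min 1 (e / (M + 1)).
have dl0 : 0 < dl by rewrite lt_min ltr01 divr_gt0// ltr_wpDl.
have : x - dl < x by rewrite gtrBl.
move=> /rat_in_itvoo[r]; rewrite in_itv /= => /andP[xr rx].
have qr : q (pickle r) = ratr r by rewrite /q pickleK.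
near=> n.
have nr : (pickle r <= n)%N by near: n; exact: nbhs_infty_ge.
rewrite ger0_norm ?subr_ge0// lerBlDr -lerBlDl.
apply: le_trans (max_affine_ge a b x nr); rewrite abE qr.
have h1 := hs x (ratr r).
have h2 : s (x - 1) <= s (ratr r).
  apply: hm; apply: le_trans (ltW xr).
  by rewrite lerD2l lerN2 ge_min lexx.
have h3 : dl * (M + 1) <= e.
  by rewrite -ler_pdivlMr ?ltr_wpDl// ge_min lexx orbT.
rewrite /M in h3.
have h4 : s x - s (ratr r) <= s x - s (x - 1) by lra.
have : (s x - s (ratr r)) * (x - ratr r) <= (s x - s (x - 1)) * (x - ratr r).
  by apply: ler_wpM2r => //; lra.
have : (s x - s (x - 1)) * (x - ratr r) <= (s x - s (x - 1)) * dl.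
  by apply: ler_wpM2l => //; lra.
nra.
Unshelve. all: by end_near.
Qed.

(** * Jensen's inequality for conditional expectations and finite maxima of affine functions *)

Section jensen.
Context d (T : measurableType d) (R : realType) (P : probability T R).

Lemma Rintegral_affine (f : T -> R) (A : set T) (u v : R) : measurable A ->
  P.-integrable A (EFin \o f) ->
  \int[P]_(w in A) (u + v * f w) = u * fine (P A) + v * \int[P]_(w in A) f w.
Proof.
move=> mA fi.
rewrite RintegralD ?Rintegral_cst ?RintegralZl//.
- exact: finite_measure_integrable_cst.
- exact: (integrableZl mA v fi).
Qed.

Lemma Rintegral_setID (f : T -> R) (A B : set T) : measurable A -> measurable B ->
  P.-integrable A (EFin \o f) ->
  \int[P]_(w in A) f w = \int[P]_(w in A `&` B) f w + \int[P]_(w in A `&` ~` B) f w.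
Proof.
move=> mA mB fi.
have E : (A `&` B) `|` (A `&` ~` B) = A by rewrite -setIUr setUv setIT.
rewrite -[in LHS]E Rintegral_setU ?E//; try exact: measurableI.
- by apply: measurableI => //; exact: measurableC.
- by apply/disj_set2P; rewrite setIACA setICr setI0.
Qed.

(** Induction on the number of lines, over all events [A] generated by [V] at once. Split [A] by
    whether the last line attains the maximum at [Z]. Where it does, the maximum at [Z] is affine
    and the identity defining [Z] replaces [Z] by [Y]; elsewhere the induction hypothesis applies.
    Both results lie below the full maximum at [Y]. *)
Lemma jensen_max_affine d' (T' : measurableType d') (V : T -> T') (Y Z : T -> R)
    (a b : nat -> R) n : is_cond_expectation P V Y Z ->
  \int[P]_w max_affine a b n (Z w) <= \int[P]_w max_affine a b n (Y w).
Proof.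
move=> [Yi Zi mZ ZY].
have mZT : measurable_fun [set: T] Z.
  by apply/measurable_EFinP; case/integrableP: Zi.
have iA (f : T -> R) A : measurable A -> P.-integrable [set: T] (EFin \o f) ->
    P.-integrable A (EFin \o f).
  by move=> mA; exact: integrableS.
have affE k A : measurable A -> g_sigma_algebra_preimage V A ->
    \int[P]_(w in A) (a k + b k * Z w) = \int[P]_(w in A) (a k + b k * Y w).
  move=> mA VA; rewrite !Rintegral_affine//; try exact: iA.
  by rewrite /Rintegral ZY.
suff H A : measurable A -> g_sigma_algebra_preimage V A ->
    \int[P]_(w in A) max_affine a b n (Z w) <=
    \int[P]_(w in A) max_affine a b n (Y w).
  apply: H => //; exact: (@measurableT _ (g_sigma_algebra_preimageType V)).
elim: n A => [|n IHn] A mA VA; first by rewrite /= affE.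
pose C := [set x : R | max_affine a b n x - (a n.+1 + b n.+1 * x) <= 0].
have mC : measurable C.
  rewrite [C](_ : _ = [set: R] `&` (fun x => max_affine a b n x -
      (a n.+1 + b n.+1 * x)) @^-1` `]-oo, 0]%classic); last first.
    by rewrite setTI; apply/seteqP; split => x /=; rewrite in_itv.
  have : measurable_fun [set: R] (fun x => max_affine a b n x -
      (a n.+1 + b n.+1 * x)).
    apply: measurable_funB; first exact: measurable_max_affine.
    by apply: measurable_funD => //; exact: measurable_funM.
  by apply => //; exact: measurable_itv.
pose B := Z @^-1` C.
have mB : measurable B by rewrite -[B]setTI; exact: mZT.
(* The split depends on [Z] alone, which is measurable for the sigma-algebra of [V], so both pieces
   of [A] stay in it. *)
have VB : g_sigma_algebra_preimage V B.
  by have := mZ measurableT C mC; rewrite setTI.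
have mAB : measurable (A `&` B) by exact: measurableI.
have mAC : measurable (A `&` ~` B) by apply: measurableI => //; exact: measurableC.
have VAB : g_sigma_algebra_preimage V (A `&` B).
  exact: (@measurableI _ (g_sigma_algebra_preimageType V)).
have VAC : g_sigma_algebra_preimage V (A `&` ~` B).
  apply: (@measurableI _ (g_sigma_algebra_preimageType V)) => //.
  exact: (@measurableC _ (g_sigma_algebra_preimageType V)).
have mai (f : T -> R) m D : measurable D -> P.-integrable [set: T] (EFin \o f) ->
    P.-integrable D (EFin \o (fun w => max_affine a b m (f w))).
  by move=> mD fi; apply: integrable_max_affine => //; exact: iA.
rewrite (Rintegral_setID mA mB (mai Z n.+1 A mA Zi)).
rewrite (Rintegral_setID mA mB (mai Y n.+1 A mA Yi)).
apply: lerD.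
- apply: (@le_trans _ _ (\int[P]_(w in A `&` B) (a n.+1 + b n.+1 * Y w))).
    rewrite -affE// /Rintegral le_eqVlt; apply/orP; left; apply/eqP; congr fine.
    apply: eq_integral => w; rewrite inE => -[_]; rewrite /B /C /= subr_le0 => h.
    by rewrite max_r.
  apply: le_Rintegral => //.
  + by apply: integrable_affine => //; exact: iA.
  + exact: (mai Y n.+1).
  + by move=> w _; rewrite /= le_max lexx orbT.
- apply: (@le_trans _ _ (\int[P]_(w in A `&` ~` B) max_affine a b n (Y w))).
    apply: le_trans (IHn _ mAC VAC).
    rewrite /Rintegral le_eqVlt; apply/orP; left; apply/eqP; congr fine.
    apply: eq_integral => w; rewrite inE => -[_]; rewrite /B /C /=.
    by rewrite subr_le0 => /negP; rewrite -ltNge => h; rewrite max_l// ltW.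
  apply: le_Rintegral => //.
  + exact: (mai Y n).
  + exact: (mai Y n.+1).
  + by move=> w _; rewrite /= le_max lexx.
Qed.

End jensen.

(** * Integrability of convex functions of random variables *)

Section convex_domination.
Context d (T : measurableType d) (R : realType) (P : probability T R).

(* A function bounded below by an integrable one always has an integral in
   ]-oo, +oo], so it is integrable as soon as that integral is not [+oo]. *)
Lemma integrable_lower_bound (f g : T -> R) :
  P.-integrable [set: T] (EFin \o f) -> measurable_fun [set: T] g ->
  (forall w, f w <= g w) -> (\int[P]_w (g w)%:E < +oo)%E ->
  P.-integrable [set: T] (EFin \o g).
Proof.
move=> fi mg fg gfin.
have mf : measurable_fun [set: T] (EFin \o f) by case/integrableP: fi.
have mgE : measurable_fun [set: T] (EFin \o g) by exact/measurable_EFinP.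
have gneg : (\int[P]_w ((EFin \o g)^\- w) < +oo)%E.
  apply: le_lt_trans (integral_funeneg_lt_pinfty measurableT fi); apply: ge0_le_integral => //.
  - exact: measurable_funeneg.
  - exact: measurable_funeneg.
  - move=> w _; rewrite !funenegE /= -!EFin_max lee_fin.
    by rewrite ge_max !le_max lexx lerN2 fg !orbT.
have gpos : (\int[P]_w ((EFin \o g)^\+ w) < +oo)%E.
  (* With a finite negative part, an infinite positive part would make the whole integral [+oo]. *)
  rewrite ltNge leye_eq; apply/negP => /eqP gpos.
  move: gfin; rewrite [ltLHS]integralE gpos addye ?ltxx//.
  by apply: contraTneq gneg => /eqP; rewrite eqe_oppLR => /eqP ->; rewrite ltxx.
apply/integrableP; split => //.
under eq_integral do rewrite -/((abse \o (EFin \o g)) _) fune_abse.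
rewrite ge0_integralD//; first by rewrite lte_add_pinfty.
- exact: measurable_funepos.
- exact: measurable_funeneg.
Qed.

(** The two bounds give [|g| <= |f| + |h|]. *)
Lemma integrable_between (f g h : T -> R) :
  P.-integrable [set: T] (EFin \o f) -> P.-integrable [set: T] (EFin \o h) ->
  measurable_fun [set: T] g -> (forall w, f w <= g w <= h w) ->
  P.-integrable [set: T] (EFin \o g).
Proof.
move=> fi hi mg fgh.
apply: (integrable_lower_bound fi mg) => [w|]; first by case/andP: (fgh w).
apply: le_lt_trans (integrable_lty measurableT hi).
apply: le_integral => //; last by move=> w _; rewrite lee_fin; case/andP: (fgh w).
have := integrableD measurableT (integrable_abse fi) (integrable_abse hi).
apply: le_integrable => //; first exact/measurable_EFinP.
move=> w _; rewrite /= lee_fin [leRHS]ger0_norm ?addr_ge0//.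
have /andP[fg gh] := fgh w.
have := ler_norm (h w); have := ler_norm (- f w); rewrite normrN => ? ?.
by rewrite ler_norml; apply/andP; split;
  have := normr_ge0 (f w); have := normr_ge0 (h w); lra.
Qed.

(** A convex function is a pointwise limit of measurable maxima of lines. *)
Lemma measurable_convex (phi : R -> R) :
  convex_function [set: R] phi -> measurable_fun [set: R] phi.
Proof.
move=> /convex_max_affine[a [b [_ cvg_phi]]].
apply: (@measurable_fun_cvg _ _ _ _ (max_affine a b)) => [n|x _].
  exact: measurable_max_affine.
exact: cvg_phi.
Qed.

Lemma measurable_convex_comp (phi : R -> R) (f : T -> R) :
  convex_function [set: R] phi -> P.-integrable [set: T] (EFin \o f) ->
  measurable_fun [set: T] (phi \o f).
Proof.
move=> /measurable_convex mphi /integrableP[/measurable_EFinP mf _].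
exact: measurableT_comp.
Qed.

(** Any affine minorant of [phi], composed with [f], is an integrable lower bound. *)
Lemma convex_integrable (phi : R -> R) (f : T -> R) :
  convex_function [set: R] phi -> P.-integrable [set: T] (EFin \o f) ->
  (\int[P]_w (phi (f w))%:E < +oo)%E ->
  P.-integrable [set: T] (EFin \o (phi \o f)).
Proof.
move=> phic fi; have [a [b [le_phi _]]] := convex_max_affine phic.
apply: integrable_lower_bound (integrable_affine (a 0) (b 0) measurableT fi) _ _.
  exact: measurable_convex_comp.
by move=> w; exact: le_phi.
Qed.

(* Since [A + U = l^-1 (l A) + (1 - l^-1) (k U)] with [k = l / (l - 1)],
   convexity turns [E f(l A) <= E f(A + U)] into [E f(l A) <= E f(k U)], first
   for [f] of linear growth, so that [E f(l A)] can be subtracted from both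
   sides, then for every convex [f] by monotone convergence. *)
Lemma convex_order_absorb (A U : T -> R) (phi : R -> R) (l : R) :
  convex_function [set: R] phi -> 1 < l ->
  P.-integrable [set: T] (EFin \o A) -> P.-integrable [set: T] (EFin \o U) ->
  (forall a b n, \int[P]_w max_affine a b n (A w * l) <=
                 \int[P]_w max_affine a b n (A w + U w)) ->
  P.-integrable [set: T] (EFin \o (fun w => phi (U w * (l / (l - 1))))) ->
  P.-integrable [set: T] (EFin \o (fun w => phi (A w * l))).
Proof.
move=> phic l1 Ai Ui dom phiUi.
have [a [b [le_phi cvg_phi]]] := convex_max_affine phic.
pose ma := max_affine a b; pose k := l / (l - 1).
have scale_i (f : T -> R) c : P.-integrable [set: T] (EFin \o f) ->
    P.-integrable [set: T] (EFin \o (fun w => f w * c)).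
  by move=> fi; apply: eq_integrable (integrableZl measurableT c fi) => //= w _;
    rewrite EFinM muleC.
have Ali := scale_i _ l Ai; have Uki := scale_i _ k Ui.
have mai f n : P.-integrable [set: T] (EFin \o f) ->
    P.-integrable [set: T] (EFin \o (fun w => ma n (f w))).
  by move=> fi; exact: integrable_max_affine.
have AUi : P.-integrable [set: T] (EFin \o (fun w => A w + U w)).
  exact: (integrableD measurableT Ai Ui).
have l0 : 0 < l by exact: lt_trans l1.
have l1_neq0 : l - 1 != 0 by rewrite subr_eq0 gt_eqF.
have bound n : \int[P]_w ma n (A w * l) <= \int[P]_w phi (U w * k).
  set I := \int[P]_w _.
  apply: (@le_trans _ _ (\int[P]_w ma n (U w * k))); last first.
    apply: le_Rintegral => //; first exact: mai.
    by move=> w _; apply: max_affine_le => j; exact: le_phi.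
  (* [I] appears on both sides; being finite, its share [l^-1 * I] moves to the left and the
     positive factor [1 - l^-1] cancels. *)
  have : I <= l^-1 * I + (1 - l^-1) * \int[P]_w ma n (U w * k).
    apply: le_trans (dom a b n) _.
    have i1 := integrableZl measurableT l^-1 (mai _ n Ali).
    have i2 := integrableZl measurableT (1 - l^-1) (mai _ n Uki).
    rewrite /I -!RintegralZl//; try exact: mai.
    rewrite -RintegralD//.
    apply: le_Rintegral => //; [exact: mai|exact: (integrableD measurableT i1 i2)|].
    move=> w _.
    have -> : A w + U w = l^-1 * (A w * l) + (1 - l^-1) * (U w * k).
      by rewrite /k; field; rewrite l1_neq0 gt_eqF.
    by apply: max_affine_convex; rewrite ?invr_ge0 ?(ltW l0)// invf_le1// ltW.
  have li : l^-1 < 1 by rewrite invf_lt1.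
  set J := \int[P]_w _ => h.
  have : (1 - l^-1) * I <= (1 - l^-1) * J by lra.
  by rewrite ler_pM2l// subr_gt0.
pose g n w := (ma n (A w * l) - ma 0 (A w * l))%:E.
have gi n : P.-integrable [set: T] (g n).
  by have := integrableB measurableT (mai _ n Ali) (mai _ 0 Ali).
have mg n : measurable_fun [set: T] (g n) by case/integrableP: (gi n).
have nd_ma x := @max_affine_nd _ a b x.
have g0 n w : [set: T] w -> (0 <= g n w)%E.
  by move=> _; rewrite lee_fin subr_ge0 nd_ma.
have nd_g w : [set: T] w -> {homo g^~ w : m n / (m <= n)%N >-> (m <= n)%E}.
  by move=> _ m n mn; rewrite lee_fin lerD2r nd_ma.
have lim_g w : limn (g^~ w) = (phi (A w * l) - ma 0 (A w * l))%:E.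
  apply/cvg_lim => //; apply/cvg_EFin; first by near=> n.
  by apply: cvgB; [exact: cvg_phi|exact: cvg_cst].
have di : P.-integrable [set: T]
    (EFin \o (fun w => phi (A w * l) - ma 0 (A w * l))).
  apply: (@integrable_lower_bound (cst 0)).
  - exact: finite_measure_integrable_cst.
  - apply: measurable_funB; first exact: measurable_convex_comp phic Ali.
    by apply/measurable_EFinP; case/integrableP: (mai _ 0 Ali).
  - by move=> w; rewrite subr_ge0; exact: le_phi.
  - have cvg_int := @cvg_monotone_convergence _ T R P _ measurableT g mg g0 nd_g.
    rewrite (eq_integral (fun w => (phi (A w * l) - ma 0 (A w * l))%:E)) in cvg_int;
      last by move=> w _; exact: lim_g.
    (* The bound on the integrals of [g n] does not depend on [n], so it passes to the limit. *)
    apply: (@le_lt_trans _ _ (\int[P]_w phi (U w * k) -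
        \int[P]_w ma 0 (A w * l))%:E); last by rewrite ltry.
    apply: (cvge_to_le cvg_int); near=> n.
    rewrite -[leLHS]fineK ?integrable_fin_num// lee_fin.
    rewrite -/(Rintegral P [set: T] (fun w => ma n (A w * l) - ma 0 (A w * l))).
    by rewrite RintegralB//; [rewrite lerD2r; exact: bound|exact: mai|exact: mai].
have := integrableD measurableT di (mai _ 0 Ali).
by apply: eq_integrable => // w _ /=; rewrite -EFinD subrK.
Unshelve. all: by end_near.
Qed.

End convex_domination.

(** * Borel measurability of maps on row vectors *)

Section random_vector.
Variables (R : realType) (p : nat).

(** Open intervals generate the Borel sets of the line, and their preimages are open. *)
Lemma continuous_measurable_borelV (f : 'rV[R]_p -> R) : continuous f ->
  measurable_fun [set: borelV R p] (f : borelV R p -> R).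
Proof.
move=> /continuousP cf; apply: (measurability _ (RGenOpens.measurableE R)) => //.
move=> _ [_ [a [b ->] <-]]; rewrite setTI; apply: sub_sigma_algebra.
exact/cf/interval_open.
Qed.

Lemma measurable_shift_borelV (m : 'rV[R]_p) :
  measurable_fun [set: borelV R p] (fun x => x - m : borelV R p).
Proof.
apply: (measurability (@open 'rV[R]_p : set (set (borelV R p)))) => //.
move=> _ [A oA <-]; rewrite setTI.
have /continuousP : continuous (fun x : 'rV[R]_p => x - m).
  by move=> x; exact: (@cvgB _ _ _ _ _ _ (cst m) _ _ (@cvg_id _ (nbhs x)) (cvg_cst m)).
by move=> /(_ _ oA) oB; exact: (@sub_sigma_algebra _ setT (@open 'rV[R]_p)).
Qed.

Lemma measurable_dotp (b : 'rV[R]_p) :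
  measurable_fun [set: borelV R p] (fun x : borelV R p => dotp x b).
Proof.
apply: measurable_sum => i; apply: measurable_funM => //.
by apply: continuous_measurable_borelV; exact: coord_continuous.
Qed.

Lemma dotpZr (l : R) (x b : 'rV[R]_p) : dotp x (l *: b) = dotp x b * l.
Proof.
by rewrite /dotp mulr_suml; apply: eq_bigr => i _; rewrite mxE mulrCA mulrC.
Qed.

Lemma dotpBl (x y b : 'rV[R]_p) : dotp (x - y) b = dotp x b - dotp y b.
Proof.
by rewrite /dotp -sumrB; apply: eq_bigr => i _; rewrite !mxE mulrBl.
Qed.

End random_vector.

(** * Transfer of expectations between couplings with the same marginals *)

Section transfer.
Context (R : realType) d1 (T1 : measurableType d1) (P1 : probability T1 R)
  d2 (T2 : measurableType d2) (P2 : probability T2 R).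

(** The image measures coincide. Positive and negative parts are transferred separately, so infinite
    integrals are covered too. *)
Lemma eq_in_dist_integral d' (T' : measurableType d') (A1 : {RV P1 >-> T'})
    (A2 : {RV P2 >-> T'}) (f : T' -> R) : eq_in_dist A1 A2 ->
  measurable_fun [set: T'] f ->
  (\int[P1]_w (f (A1 w))%:E = \int[P2]_w (f (A2 w))%:E)%E.
Proof.
move=> A12 mf; have mfE : measurable_fun [set: T'] (EFin \o f).
  exact/measurable_EFinP.
have nneg (g : T' -> \bar R) : measurable_fun [set: T'] g ->
    (forall x, (0 <= g x)%E) ->
    (\int[P1]_w (g \o A1) w = \int[P2]_w (g \o A2) w)%E.
  move=> mg g0.
  have mA1 : measurable_fun [set: T1] A1 by exact: measurable_funPT.
  have mA2 : measurable_fun [set: T2] A2 by exact: measurable_funPT.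
  transitivity (\int[pushforward P1 A1]_x g x)%E.
    by rewrite (ge0_integral_pushforward mA1).
  transitivity (\int[pushforward P2 A2]_x g x)%E.
    by apply: eq_measure_integral => B mB _; exact: A12.
  by rewrite (ge0_integral_pushforward mA2).
rewrite integralE [RHS]integralE.
rewrite (funepos_comp (EFin \o f) A1) (funeneg_comp (EFin \o f) A1).
rewrite (funepos_comp (EFin \o f) A2) (funeneg_comp (EFin \o f) A2).
by congr (_ - _)%E; apply: nneg => //;
  [exact: measurable_funepos|exact: measurable_funeneg].
Qed.

Variables (p : nat) (X1 : {RV P1 >-> borelV R p}) (X2 : {RV P2 >-> borelV R p})
  (Y1 : {RV P1 >-> R}) (Y2 : {RV P2 >-> R}).
Hypotheses (X12 : eq_in_dist X1 X2) (Y12 : eq_in_dist Y1 Y2).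

(** The means agree as well, so both centerings subtract the same constant. *)
Lemma eq_in_dist_centered (f : R -> R) : measurable_fun [set: R] f ->
  \int[P1]_w f (centered P1 Y1 w) = \int[P2]_w f (centered P2 Y2 w).
Proof.
move=> mf.
have EY : 'E_P1[Y1]%E = 'E_P2[Y2]%E.
  by rewrite unlock; exact: (eq_in_dist_integral Y12 (@measurable_id _ R setT)).
rewrite /centered EY /Rintegral; congr fine.
have mg : measurable_fun [set: R] (fun y => f (y - fine 'E_P2[Y2]%E)).
  by apply: measurableT_comp => //; exact: measurable_funB.
exact: (eq_in_dist_integral Y12 mg).
Qed.

Lemma eq_in_dist_dotp_centeredV (b : 'rV[R]_p) (f : R -> R) :
  measurable_fun [set: R] f ->
  \int[P1]_w f (dotp (centeredV P1 X1 w) b) =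
  \int[P2]_w f (dotp (centeredV P2 X2 w) b).
Proof.
move=> mf; rewrite /centeredV.
have -> : \row_i fine 'E_P1[coord_of X1 i]%E = \row_i fine 'E_P2[coord_of X2 i]%E.
  apply/rowP => i; rewrite !mxE unlock; congr fine.
  have mc : measurable_fun [set: borelV R p] (fun x : borelV R p => x 0 i).
    by apply: continuous_measurable_borelV; exact: coord_continuous.
  exact: (eq_in_dist_integral X12 mc).
set m := \row_i _; rewrite /Rintegral; congr fine.
have mg : measurable_fun [set: borelV R p]
    (fun x : borelV R p => f (dotp (x - m) b)).
  apply: measurableT_comp => //.
  exact: measurableT_comp (measurable_dotp b) (measurable_shift_borelV m).
exact: (eq_in_dist_integral X12 mg).
Qed.

(* The coupling [(X2, Y2)] makes [l X0'b] smaller than [Y0] in the convex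
   order, a property of the marginal distributions alone. *)
Lemma convex_index_integrable (b : 'rV[R]_p) (l : R) (phi : R -> R) :
  is_cond_expectation P1 (centeredV P1 X1 : T1 -> borelV R p) (centered P1 Y1)
    (fun w => dotp (centeredV P1 X1 w) b) ->
  is_cond_expectation P2 (centeredV P2 X2 : T2 -> borelV R p) (centered P2 Y2)
    (fun w => dotp (centeredV P2 X2 w) (l *: b)) ->
  1 < l -> convex_function [set: R] phi ->
  (\int[P1]_w (phi (residual P1 X1 Y1 b w * (l / (l - 1))))%:E < +oo)%E ->
  P1.-integrable [set: T1]
    (EFin \o (fun w => phi (dotp (centeredV P1 X1 w) b * l))).
Proof.
move=> [Y1i Z1i _ _] ce2 l1 phic phiU.
have Ui : P1.-integrable [set: T1] (EFin \o residual P1 X1 Y1 b).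
  by have := integrableB measurableT Y1i Z1i.
have Uki : P1.-integrable [set: T1]
    (EFin \o (fun w => residual P1 X1 Y1 b w * (l / (l - 1)))).
  by apply: eq_integrable (integrableZl measurableT (l / (l - 1)) Ui) => // w _;
    rewrite EFinM muleC.
apply: (convex_order_absorb phic l1 Z1i Ui); last exact: convex_integrable.
move=> u v n.
(* The left side is moved to the second coupling through the law of [X], the right side, whose
   argument is the centered [Y1], through the law of [Y]; there Jensen's inequality compares
   them. *)
under eq_Rintegral do rewrite -dotpZr.
under [leRHS]eq_Rintegral do rewrite /residual addrC subrK.
rewrite (eq_in_dist_dotp_centeredV _ (measurable_max_affine u v n)).
rewrite (eq_in_dist_centered (measurable_max_affine u v n)).
exact: jensen_max_affine ce2.
Qed.

End transfer.

Lemma ord_eq1 n (i j : 'I_n) : n = 1%N -> i = j.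
Proof. by move=> n1; subst n; rewrite !ord1. Qed.

(** * From the regression of Y on X to its centered form *)

Section centering.
Context (R : realType) d (T : measurableType d) (P : probability T R) (p : nat)
  (X : {RV P >-> borelV R p}).

Lemma dotp_ge0 (x : 'rV[R]_p) : 0 <= dotp x x.
Proof. by apply: sumr_ge0 => i _; rewrite -expr2 sqr_ge0. Qed.

(** Each coordinate satisfies [|x| <= 1 + x^2], and [x^2] is at most the squared norm. *)
Lemma integrable_coord (i : 'I_p) : ('E_P[fun w => dotp (X w) (X w)] < +oo)%E ->
  P.-integrable [set: T] (EFin \o coord_of X i).
Proof.
rewrite unlock => hX2.
have mX j : measurable_fun [set: T] (coord_of X j).
  apply: (measurableT_comp (f := fun x : borelV R p => x 0 j)) => //.
  by apply: continuous_measurable_borelV; exact: coord_continuous.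
have mXX : measurable_fun [set: T] (fun w => dotp (X w) (X w)).
  by apply: measurable_sum => j; apply: measurable_funM; exact: mX.
have XXi : P.-integrable [set: T] (EFin \o (fun w => dotp (X w) (X w))).
  apply: (@integrable_lower_bound _ _ _ _ (cst 0)) => //.
    exact: finite_measure_integrable_cst.
  by move=> w; exact: dotp_ge0.
apply: (le_integrable _ _ _ (integrable_affine 1 1 measurableT XXi)) => //.
  exact/measurable_EFinP.
move=> w _; rewrite /= mul1r lee_fin [leRHS]ger0_norm ?addr_ge0 ?dotp_ge0//.
have : X w 0 i * X w 0 i <= dotp (X w) (X w).
  rewrite /dotp (bigD1 i)//= lerDl; apply: sumr_ge0 => j _.
  by rewrite -expr2 sqr_ge0.
rewrite /coord_of -expr2 -real_normK ?num_real// => h.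
have := sqr_ge0 (`|X w 0 i| - 1); have := normr_ge0 (X w 0 i); nra.
Qed.

Lemma Rintegral_dotp (b : 'rV[R]_p) :
  (forall i, P.-integrable [set: T] (EFin \o coord_of X i)) ->
  P.-integrable [set: T] (EFin \o (fun w => dotp (X w) b)) /\
  \int[P]_w dotp (X w) b = dotp (\row_i fine 'E_P[coord_of X i]%E) b.
Proof.
move=> Xi.
have bXi i : P.-integrable [set: T] (fun w => (X w 0 i * b 0 i)%:E).
  by apply: eq_integrable (integrableZl measurableT (b 0 i) (Xi i)) => // w _;
    rewrite /= mulrC.
have E w : (dotp (X w) b)%:E = (\sum_(i < p) (X w 0 i * b 0 i)%:E)%E.
  by rewrite sumEFin.
split.
  apply: eq_integrable (integrable_sum measurableT (index_enum 'I_p) (P := xpredT)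
    (fun i _ => bXi i)) => // w _.
  by rewrite /= E.
rewrite /Rintegral; under eq_integral do rewrite E.
rewrite integral_sum// -sum_fine; last by move=> i _; exact: integrable_fin_num.
apply: eq_bigr => i _; rewrite mxE unlock -/(Rintegral P setT (fun w => X w 0 i * b 0 i)).
under eq_Rintegral do rewrite mulrC.
rewrite (@RintegralZl _ _ _ P _ (coord_of X i) (b 0 i) measurableT (Xi i)).
by rewrite mulrC.
Qed.

(** Centering subtracts the constant [E(Y)] from both the outcome and its conditional expectation,
    and translating [X] creates no new events. *)
Lemma is_cond_expectation_centered (Y : T -> R) (alpha : R) (b : 'rV[R]_p) :
  (forall i, P.-integrable [set: T] (EFin \o coord_of X i)) ->
  is_cond_expectation P X Y (fun w => alpha + dotp (X w) b) ->
  is_cond_expectation P (centeredV P X : T -> borelV R p) (centered P Y)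
    (fun w => dotp (centeredV P X w) b).
Proof.
move=> Xi [Yi Zi mZ ZY].
pose m := \row_i fine 'E_P[coord_of X i]%E.
have [Xbi EXb] := Rintegral_dotp b Xi.
have sXT : g_sigma_algebra_preimage X [set: T].
  exact: (@measurableT _ (g_sigma_algebra_preimageType X)).
(* The defining identity on the whole space gives the mean of [Y], which eliminates [alpha]. *)
have EY : fine 'E_P[Y]%E = alpha + dotp m b.
  rewrite unlock -ZY//.
  rewrite -/(Rintegral P setT (fun w => alpha + dotp (X w) b)).
  have := Rintegral_affine alpha 1 measurableT Xbi.
  rewrite probability_setT mulr1 mul1r EXb => <-.
  by apply: eq_Rintegral => w _; rewrite mul1r.
have ZE w : dotp (centeredV P X w) b = - fine 'E_P[Y]%E + 1 * (alpha + dotp (X w) b).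
  by rewrite EY /centeredV dotpBl -/m; ring.
have YE w : centered P Y w = - fine 'E_P[Y]%E + 1 * Y w by rewrite /centered; ring.
have Z0i : P.-integrable [set: T] (EFin \o (fun w => dotp (centeredV P X w) b)).
  apply: eq_integrable (integrable_affine (- fine 'E_P[Y]%E) 1 measurableT Zi) => //.
  by move=> w _; rewrite /= ZE.
have Y0i : P.-integrable [set: T] (EFin \o centered P Y).
  apply: eq_integrable (integrable_affine (- fine 'E_P[Y]%E) 1 measurableT Yi) => //.
  by move=> w _; rewrite /= YE.
split => //.
  move=> _ B mB; exists ((fun x : borelV R p => dotp x b) @^-1` B) => //.
  by rewrite -[X in measurable X]setTI; exact: measurable_dotp.
move=> A [B mB <-]; rewrite setTI.
(* An event of the centered vector is the event of [X] for the translated Borel set. *)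
have XA : g_sigma_algebra_preimage X ((centeredV P X : T -> borelV R p) @^-1` B).
  exists ((fun x : borelV R p => x - m) @^-1` B); last by rewrite setTI.
  by rewrite -[X in measurable X]setTI; exact: measurable_shift_borelV.
have mA : measurable ((centeredV P X : T -> borelV R p) @^-1` B).
  case: XA => C mC <-; exact: measurable_funPT.
have iA (f : T -> R) : P.-integrable [set: T] (EFin \o f) ->
    P.-integrable ((centeredV P X : T -> borelV R p) @^-1` B) (EFin \o f).
  exact: integrableS.
rewrite -[LHS]fineK ?integrable_fin_num//; last exact: iA.
rewrite -[RHS]fineK ?integrable_fin_num//; last exact: iA.
congr EFin.
rewrite -/(Rintegral P _ (fun w => dotp (centeredV P X w) b)).
rewrite -/(Rintegral P _ (centered P Y)).
rewrite [LHS](@eq_Rintegral _ _ _ P _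
  (fun w => - fine 'E_P[Y]%E + 1 * (alpha + dotp (X w) b)));
  last by move=> w _; exact: ZE.
rewrite [RHS](@eq_Rintegral _ _ _ P _ (fun w => - fine 'E_P[Y]%E + 1 * Y w));
  last by move=> w _; exact: YE.
rewrite !Rintegral_affine//; try exact: iA.
by rewrite /Rintegral ZY.
Qed.

End centering.

(** * Consequences of membership in the unrestricted set *)

Section identified_set_theory.
Context (R : realType) (p : nat) d (T : measurableType d) (P : probability T R)
  (X : {RV P >-> borelV R p}) (Y : {RV P >-> R}).

Lemma identified_set_no_restriction (r : restriction R p) :
  identified_set X Y r `<=` identified_set X Y (@no_restriction R p).
Proof.
by move=> b [d1 [T1 [P1 [X1 [Y1 [ce1 X1X Y1Y _]]]]]];
  exists d1, T1, P1, X1, Y1; split.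
Qed.

(** The coupling realizing [l *: b] and the one realizing [b] share the marginals of [X] and [Y], so
    [convex_index_integrable] applies to the pair. *)
Lemma convex_identified_index_integrable d1 (T1 : measurableType d1)
    (P1 : probability T1 R) (X1 : {RV P1 >-> borelV R p}) (Y1 : {RV P1 >-> R})
    (b : 'rV[R]_p) (l : R) (phi : R -> R) :
  is_cond_expectation P1 (centeredV P1 X1 : T1 -> borelV R p) (centered P1 Y1)
    (fun w => dotp (centeredV P1 X1 w) b) ->
  eq_in_dist X1 X -> eq_in_dist Y1 Y ->
  identified_set X Y (@no_restriction R p) (l *: b) ->
  1 < l -> convex_function [set: R] phi ->
  ('E_P1[fun w => phi (residual P1 X1 Y1 b w * (l / (l - 1)))%R] < +oo)%E ->
  P1.-integrable [set: T1]
    (EFin \o (fun w => phi (dotp (centeredV P1 X1 w) b * l))).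
Proof.
move=> ce1 X1X Y1Y [d2 [T2 [P2 [X2 [Y2 [ce2 X2X Y2Y _]]]]]] l1 phic.
rewrite unlock; apply: (convex_index_integrable _ _ ce1 ce2) => // B mB.
- by rewrite X1X// X2X.
- by rewrite Y1Y// Y2Y.
Qed.

Lemma expectation_neqy (f : T -> R) :
  P.-integrable [set: T] (EFin \o f) -> ('E_P[f] <> +oo)%E.
Proof.
by move=> /(integrable_fin_num measurableT); rewrite unlock => /[swap] ->.
Qed.

End identified_set_theory.

(** * Tail conditions exclude larger multiples of a candidate *)

Section identified_sets_with_tails.
Context (R : realType) (p : nat) d (T : measurableType d) (P : probability T R)
  (X : {RV P >-> borelV R p}) (Y : {RV P >-> R}).

(** Ensures that the scale put on the residual is in the range [l > 1] covered by [index_tail]. *)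
Let gt1_div (l : R) : 1 < l -> 1 < l / (l - 1).
Proof. by move=> l1; rewrite ltr_pdivlMr ?subr_gt0// mul1r gtrBl. Qed.

(** The tail condition is used at two scales: at [l / (l - 1)] it makes the residual term finite, at
    [l] it makes the index term infinite, against the integrability that [l *: b] would force. *)
Lemma index_tail_not_scalable (b : 'rV[R]_p) (l : R) : 1 < l ->
  identified_set X Y (@index_tail R p) b ->
  ~ identified_set X Y (@no_restriction R p) (l *: b).
Proof.
move=> l1 [d1 [T1 [P1 [X1 [Y1 [ce1 X1X Y1Y [phi [phic tail]]]]]]]] lb.
have [Eoo _] := tail _ (gt1_div l1).
have [_ /expectation_neqy] := tail _ l1; apply.
apply: (convex_identified_index_integrable ce1 X1X Y1Y lb l1 phic).
by apply: lt_le_trans Eoo _; rewrite leey.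
Qed.

(* The uncentered regressor is handled by convexity: with [k = b l / 2],
   [X k] is the midpoint of [l X0 b] and of the constant [2 k E(X)]. *)
Lemma positive_regressor_tail_not_scalable (j : 'I_p) (b : 'rV[R]_p) (l : R) :
  p = 1%N -> 1 < l -> identified_set X Y (@positive_regressor_tail R p j) b ->
  ~ identified_set X Y (@no_restriction R p) (l *: b).
Proof.
move=> p1 l1 [d1 [T1 [P1 [X1 [Y1 [ce1 X1X Y1Y [[phi [phic tail]] bj]]]]]]] lb.
have l0 : 0 < l by exact: lt_trans l1.
have q0 : 0 < l / (l - 1) by rewrite divr_gt0// subr_gt0.
have [Eoo _] := tail _ q0.
have phiAi := convex_identified_index_integrable ce1 X1X Y1Y lb l1 phic
  (lt_le_trans Eoo (leey _)).
have Ai : P1.-integrable [set: T1] (EFin \o (fun w => dotp (centeredV P1 X1 w) b)).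
  by case: ce1.
pose m := fine 'E_P1[coord_of X1 j]%E.
have AE w : dotp (centeredV P1 X1 w) b = (coord_of X1 j w - m) * b 0 j.
  rewrite /dotp (bigD1 j)//= big1 ?addr0; first by rewrite !mxE.
  by move=> i; rewrite (ord_eq1 i j p1) eqxx.
pose k := b 0 j * l / 2.
have k0 : 0 < k by rewrite divr_gt0// mulr_gt0.
have [_ /expectation_neqy] := tail _ k0; apply.
have XkE w : coord_of X1 j w * k = k * m + (l / 2) * dotp (centeredV P1 X1 w) b.
  by rewrite AE /k; field.
have Xki : P1.-integrable [set: T1] (EFin \o (fun w => coord_of X1 j w * k)).
  apply: eq_integrable (integrable_affine (k * m) (l / 2) measurableT Ai) => //.
  by move=> w _; rewrite /= XkE.
have [u [v [le_phi _]]] := convex_max_affine phic.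
(* Below stands an affine minorant of [phi] at [X k], above the midpoint convexity bound. *)
apply: (integrable_between (integrable_affine (u 0) (v 0) measurableT Xki)
  (integrable_affine (2^-1 * phi (2 * k * m)) 2^-1 measurableT phiAi)).
  exact: measurable_convex_comp phic Xki.
move=> w; rewrite le_phi /=.
have -> : coord_of X1 j w * k =
    2^-1 * (2 * k * m) + (1 - 2^-1) * (dotp (centeredV P1 X1 w) b * l).
  by rewrite XkE; field.
have := @convex_function_le _ phi phic 2^-1 (2 * k * m)
  (dotp (centeredV P1 X1 w) b * l).
have -> : 1 - 2^-1 = 2^-1 :> R by field.
by apply; rewrite ?invr_ge0// invf_le1// ler1n.
Qed.

(** [l *: b] tends to [b] as [l] decreases to 1. *)
Lemma interior_scale (V : normedModType R) (B : set V) (b : V) :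
  interior B b -> exists2 l : R, 1 < l & B (l *: b).
Proof.
move=> Bb.
have near_B : \forall l \near (1 : R)^'+, B (l *: b).
  by apply: cvg_within; apply: (@scalel_continuous _ _ b 1 B); rewrite scale1r.
have near_1 : \forall l \near (1 : R)^'+, 1 < l by exact: nbhs_right_gt.
by have [l [lB l1]] := filter_ex (filterI near_B near_1); exists l.
Qed.

End identified_sets_with_tails.

Theorem proposition5 (R : realType) (p : nat)
    (d : measure_display) (T : measurableType d) (P : probability T R)
    (X : {RV P >-> borelV R p}) (Y : {RV P >-> R})
    (alpha0 : R) (beta0 : 'rV[R]_p)
    (hY2 : ('E_P[fun w => (Y w ^+ 2)%R] < +oo)%E)
    (hX2 : ('E_P[fun w => dotp (X w) (X w)] < +oo)%E)
    (hVY : (0 < 'V_P[Y])%E)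
    (hVX : covmx P X \in unitmx)
    (hYX : is_cond_expectation P X Y (fun w => alpha0 + dotp (X w) beta0)) :
  (index_tail P X Y beta0 (residual P X Y beta0) ->
     identified_set X Y (@index_tail R p)
       `<=` boundary (identified_set X Y (@no_restriction R p)))
  /\
  (forall j : 'I_p, p = 1%N ->
     positive_regressor_tail j P X Y beta0 (residual P X Y beta0) ->
     identified_set X Y (@positive_regressor_tail R p j) = [set beta0]).
Proof.
have Xi i := integrable_coord i hX2.
split=> [_ b bI|j p1 tail0].
  split; first by apply: subset_closure; exact: identified_set_no_restriction bI.
  by move=> /interior_scale[l l1]; exact: index_tail_not_scalable bI.
(* The given pair is itself an admissible coupling for [beta0]. *)
have b0I : identified_set X Y (@positive_regressor_tail R p j) beta0.
  exists d, T, P, X, Y; split => //.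
  exact: is_cond_expectation_centered hYX.
have scaleE (b b' : 'rV[R]_p) : 0 < b 0 j -> b' = (b' 0 j / b 0 j) *: b.
  by move=> bj; apply/rowP => i; rewrite mxE (ord_eq1 i j p1) divfK// gt_eqF.
(* Otherwise [b'] would be a multiple of [b] by a factor above 1, positivity of [b] giving the ratio
   its sense; using this in both orders forces equality. *)
have le_I b b' : identified_set X Y (@positive_regressor_tail R p j) b ->
    identified_set X Y (@positive_regressor_tail R p j) b' -> b' 0 j <= b 0 j.
  move=> bI b'I; rewrite leNgt; apply/negP => bb'.
  have bj : 0 < b 0 j by case: bI => d1 [T1 [P1 [X1 [Y1 [_ _ _ []]]]]].
  have l1 : 1 < b' 0 j / b 0 j by rewrite ltr_pdivlMr// mul1r.
  apply: (positive_regressor_tail_not_scalable p1 l1 bI).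
  by rewrite -scaleE//; exact: identified_set_no_restriction b'I.
apply/seteqP; split=> [b bI|b ->//].
by apply/rowP => i; rewrite (ord_eq1 i j p1); apply/eqP; rewrite eq_le !le_I.
Qed.
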